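(* Let $p \in (0,1)$ and $\epsilon \in (0,1)$. Consider the message passing model on a connected undirected graph $G=(V,E)$ with $m$ vertices and diameter $d$, where player $i$ holds $X_i \in \{0,1,\dots,M\}^n$ and $\mathcal{X}=\sum_i X_i$. There is a protocol for $F_p$ estimation (outputting a $(1\pm\epsilon)$-approximation of $\|\mathcal{X}\|_p$) which succeeds with probability $2/3$ and uses a total communication of $O\!\left(\frac{m}{\epsilon^2}(\log\log n + \log(1/\epsilon))\right)$ bits and a max communication of $O\!\left(\frac{1}{\epsilon^2}(\log\log n + \log(1/\epsilon))\right)$ bits. The protocol requires a total of at most $d$ rounds.
   Context: Message passing model: there are $m$ players, one at each vertex of a connected undirected graph $G$ known to all players; player $i$ receives only its non-negative integer input vector $X_i$; a player may send a message only to a neighbor in $G$, received only by that neighbor; the players share a public random string; at termination a pre-specified player holds the output. Total communication is the total number of bits sent; max communication is the maximum number of bits sent across any single edge. $F_p = \|\mathcal{X}\|_p^p = \sum_j |\mathcal{X}_j|^p$. Standing assumption: $m, M = O(n^{c})$ for a constant $c$, so $\log(nmM)=O(\log n)$. *)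

(* Defs.v *)
From mathcomp Require Import all_boot all_order all_algebra.
From mathcomp Require Import reals exp.

Set Implicit Arguments.
Unset Strict Implicit.
Unset Printing Implicit Defensive.

Import Order.TTheory GRing.Theory Num.Theory.

Local Open Scope ring_scope.

Section Graph.
Variables (V : finType) (e : rel V).

Definition simple_graph : Prop := symmetric e /\ irreflexive e.

Definition connected_graph : Prop := forall u v : V, connect e u v.

Definition walk (k : nat) (u v : V) : bool :=
  [exists s : k.-tuple V, path e u s && (last u s == v)].

(* Least length of a walk from u to v. Shortest walks have fewer than #|V|
   edges, so the search range is enough; unreachable pairs get #|V|. *)
Definition gdist (u v : V) : nat :=
  find (fun k => walk k u v) (iota 0 #|V|).

Definition diameter : nat := (\max_(u : V) \max_(v : V) gdist u v)%N.

End Graph.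

(* One round's messages received by a player, indexed by sender; the empty
   bit string means that nothing was sent. *)
Definition inbox (V : finType) : Type := {ffun V -> seq bool}.

(* A public-coin protocol with synchronous rounds: the players at the vertices
   V have inputs in I, share [coins] uniform random bits, and the output is in
   O. The message [send u x r h v] from u to v is a function of u's input x,
   the random string r and the inboxes h of u in the previous rounds, oldest
   first, so that [size h] is the index of the current round. *)
Record protocol (V : finType) (I O : Type) : Type := Protocol {
  coins : nat;
  rounds : nat;
  send : V -> I -> coins.-tuple bool -> seq (inbox V) -> V -> seq bool;
  output : I -> coins.-tuple bool -> seq (inbox V) -> O
}.

Section Execution.
Variables (V : finType) (e : rel V) (I O : Type) (P : protocol V I O).
Variables (X : V -> I) (r : (coins P).-tuple bool).

(* Messages between non-neighbours are discarded, at no cost. *)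
Definition message (h : V -> seq (inbox V)) (u v : V) : seq bool :=
  if e u v then send u (X u) r (h u) v else [::].

Fixpoint history (t : nat) : V -> seq (inbox V) :=
  if t is t'.+1 then
    fun v => rcons (history t' v) [ffun u => message (history t') u v]
  else fun=> [::].

Definition bits_sent (u v : V) : nat :=
  (\sum_(t < rounds P) size (message (history t) u v))%N.

Definition total_communication : nat :=
  (\sum_(u : V) \sum_(v : V) bits_sent u v)%N.

(* Both directions of an edge are counted together. *)
Definition max_communication : nat :=
  (\max_(u : V) \max_(v : V | e u v) (bits_sent u v + bits_sent v u))%N.

Definition result (root : V) : O :=
  output (X root) r (history (rounds P) root).

End Execution.

Definition coin_prob (R : realType) (L : nat) (E : pred (L.-tuple bool)) : R :=
  #|[set r | E r]|%:R / (2 ^ L)%N%:R.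

Section Moments.
Variables (R : realType) (n : nat).

Definition Fp (p : R) (x : 'I_n -> R) : R := \sum_(j < n) `|x j| `^ p.

Definition pnorm (p : R) (x : 'I_n -> R) : R := Fp p x `^ p^-1.

Definition sum_vector (M : nat) (V : finType)
    (X : V -> {ffun 'I_n -> 'I_M.+1}) (j : 'I_n) : R :=
  (\sum_(i : V) X i j)%N%:R.

End Moments.

Definition approximates (R : realType) (eps a b : R) : bool :=
  `|a - b| <= eps * b.

(* Main.v *)
Require Import Defs.
From mathcomp Require Import all_boot all_order all_algebra.
From mathcomp Require Import reals sequences exp.
From mathcomp Require Import ring lra.

Set Implicit Arguments.
Unset Strict Implicit.
Unset Printing Implicit Defensive.

Import Order.TTheory GRing.Theory Num.Theory.

Local Open Scope ring_scope.

(* Fix a scale s and let every player be missed with probability exp(-s X_i(j)),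
   independently.  Nobody is hit with probability exp(-s x_j), where x is the
   sum of the inputs, so drawing j uniformly and s from weights w_i on scales
   s_i makes a public "test" hit someone with probability proportional to
   sum_j phi(x_j), phi(x) = sum_i w_i (1 - exp(-s_i x)).  A geometric grid of
   scales makes phi(x) as close to x^p as desired: this is where p < 1 enters.
   Hence no player is hit by the first lambda/constant tests with probability
   close to exp(-lambda F_p).

   Let lambda run through a geometric progression of ratio 1 + O(eps) from
   1/poly(n) up to O(1).  Each player computes the first level at which it is
   hit; there are O(log n / eps) levels, so a level costs
   O(log log n + log 1/eps) bits.  The sketch of the sum is the minimum of the
   players' levels, which is computed without any loss of precision along a
   breadth-first tree, each player speaking once.  With O(1/eps^2) independent
   repetitions, Chebyshev's inequality locates the level at which the survival
   frequency crosses exp(-1), i.e. lambda F_p = 1, up to a factor 1 + O(eps).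

   The number of tests and of random bits is free, so all the real-valued
   distributions used here are finite and are realised by public coins up to
   an arbitrarily small error. *)

(** * Finite distributions *)

Section FiniteDistributions.
Variable R : realType.

Definition distribution (T : finType) (w : T -> R) : Prop :=
  (forall x, 0 <= w x) /\ \sum_x w x = 1.

Definition prob (T : finType) (w : T -> R) (E : pred T) : R :=
  \sum_(x | E x) w x.

Definition product_weight (I T : finType) (w : I -> T -> R)
    (f : {ffun I -> T}) : R := \prod_i w i (f i).

Lemma prob_indicator (T : finType) (w : T -> R) (E : pred T) :
  prob w E = \sum_x w x * (E x)%:R.
Proof.
rewrite /prob big_mkcond; apply: eq_bigr => x _.
by case: (E x); rewrite ?mulr1 ?mulr0.
Qed.

Lemma eq_prob (T : finType) (w : T -> R) (E F : pred T) :
  E =1 F -> prob w E = prob w F.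
Proof. exact: eq_bigl. Qed.

Lemma prob_union (T : finType) (w : T -> R) (E F G : pred T) :
  (forall x, 0 <= w x) -> (forall x, E x -> F x || G x) ->
  prob w E <= prob w F + prob w G.
Proof.
move=> w0 EFG; rewrite !prob_indicator -big_split; apply: ler_sum => x _ /=.
rewrite -mulrDr; apply: ler_wpM2l => //; rewrite -natrD ler_nat.
by case: (E x) (EFG x) => // /(_ isT); case: (F x); case: (G x).
Qed.

Lemma prob_compl (T : finType) (w : T -> R) (E : pred T) :
  distribution w -> prob w (fun x => ~~ E x) = 1 - prob w E.
Proof. by case=> _ <-; rewrite [\sum_x _](bigID E) /= addrAC subrr add0r. Qed.

Lemma product_expectation (I T : finType) (w g : I -> T -> R) :
  \sum_f product_weight w f * (\prod_i g i (f i))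
  = \prod_i \sum_x w i x * g i x.
Proof.
by rewrite bigA_distr_bigA; apply: eq_bigr => f _; rewrite -big_split.
Qed.

Lemma product_distribution (I T : finType) (w : I -> T -> R) :
  (forall i, distribution (w i)) -> distribution (product_weight w).
Proof.
move=> wd; split; first by move=> f; apply: prodr_ge0 => i _; case: (wd i).
rewrite /product_weight -bigA_distr_bigA.
by apply: big1 => i _; case: (wd i).
Qed.

Lemma product_prob (I T : finType) (w : I -> T -> R) (E : I -> pred T) :
  prob (product_weight w) (fun f => [forall i, E i (f i)])
  = \prod_i prob (w i) (E i).
Proof.
rewrite prob_indicator; under [RHS]eq_bigr do rewrite prob_indicator.
rewrite -product_expectation; apply: eq_bigr => f _; congr (_ * _).
case: (boolP [forall i, _]) => [/forallP Ef | /forallPn[i Ei]].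
  by rewrite big1 // => i _; rewrite Ef.
by rewrite (bigD1 i) //= (negbTE Ei) mul0r.
Qed.

(** Give each outcome [x] the integer part of [2 ^ L * w x] strings. Each outcome loses less than
    one string, so an event loses at most [#|T| / 2 ^ L <= d]. *)
Lemma dyadic_sampling (T : finType) (w : T -> R) (d : R) :
    distribution w -> 0 < d ->
  exists L (f : L.-tuple bool -> T), forall E : pred T,
    prob w E - d <= coin_prob R (fun r => E (f r)).
Proof.
case=> w0 w1 d0.
have [x0 _] : exists x0 : T, true.
  case: (pickP (xpredT : pred T)) => [x _|T0]; first by exists x.
  by move: w1; rewrite big_pred0 // => /eqP; rewrite eq_sym oner_eq0.
pose L := (Num.trunc (#|T|%:R / d)).+1; exists L.
have Lbig : #|T|%:R / d <= (2 ^ L)%:R.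
  apply: ltW; apply: lt_le_trans (truncnS_gt _) _.
  by rewrite ler_nat ltnW // ltn_expl.
have Q0 : 0 < (2 ^ L)%:R :> R by rewrite ltr0n expn_gt0.
pose c x := Num.trunc ((2 ^ L)%:R * w x).
have cle x : (c x)%:R <= (2 ^ L)%:R * w x.
  by rewrite truncn_le mulr_ge0 ?ler0n.
have cgt x : (2 ^ L)%:R * w x < (c x)%:R + 1 by rewrite natr1 truncnS_gt.
pose s := flatten [seq nseq (c x) x | x <- enum T].
have cntE (E : pred T) : count E s = (\sum_(x | E x) c x)%N.
  rewrite /s count_flatten -map_comp sumnE big_map big_enum /=.
  rewrite [RHS]big_mkcond /=; apply: eq_bigr => x _ /=.
  by rewrite count_nseq; case: (E x); rewrite ?mul1n.
have ss : (size s <= 2 ^ L)%N.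
  rewrite -(@count_predT _ s) cntE -(ler_nat R) natr_sum.
  apply: (le_trans (ler_sum _ (fun i _ => cle i))).
  by rewrite -mulr_sumr w1 mulr1.
(* Strings beyond the end of [s] fall on the default [x0]; they can only increase the probability of
   [E]. *)
exists (fun r => nth x0 s (enum_rank r)) => E.
rewrite /coin_prob ler_pdivlMr //.
have -> : #|[set r : L.-tuple bool | E (nth x0 s (enum_rank r))]|
    = (\sum_(0 <= i < 2 ^ L) E (nth x0 s i))%N.
  rewrite -sum1_card big_mkcond /= (reindex_onto enum_val enum_rank) /=; last first.
    by move=> r _; rewrite enum_rankK.
  have -> : (2 ^ L)%N = #|{: L.-tuple bool}| by rewrite card_tuple card_bool.
  rewrite big_mkord; apply: eq_big => [i|i _]; first by rewrite enum_valK eqxx.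
  by rewrite inE enum_valK; case: (E _).
apply: (@le_trans _ _ (\sum_(x | E x) c x)%N%:R); last first.
  rewrite ler_nat -cntE (@big_cat_nat _ _ _ (size s)) //=.
  rewrite -sumn_count sumnE big_map.
  by rewrite (big_nth x0) leq_addr.
rewrite natr_sum mulrBl lerBlDr.
apply: (@le_trans _ _ (\sum_(x | E x) ((c x)%:R + 1))).
  rewrite /prob mulr_suml; apply: ler_sum => x _.
  by rewrite mulrC ltW.
rewrite big_split lerD2l /= sumr_const -[1 *+ _]/(_%:R).
apply: (@le_trans _ _ #|T|%:R); first by rewrite ler_nat max_card.
by rewrite mulrC -ler_pdivrMr.
Qed.

(** Centred indicators of distinct repetitions are uncorrelated, each of variance at most 1, so
    their sum has second moment at most [k]. *)
Lemma chebyshev_frequency (T : finType) (w : T -> R) (k : nat) (E : pred T)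
    (t : R) : distribution w -> (0 < k)%N -> 0 < t ->
  prob (product_weight (fun _ : 'I_k => w))
    (fun f => t <= `| #|[set q | E (f q)]|%:R / k%:R - prob w E|)
  <= (k%:R * t ^+ 2)^-1.
Proof.
move=> wd k0 t0; case: (wd) => w0 w1.
set P := product_weight _; set s := prob w E.
have [P0 P1] : distribution P by exact: product_distribution.
have k0' : 0 < k%:R :> R by rewrite ltr0n.
pose a x : R := (E x)%:R - s.
have Ea : \sum_x w x * a x = 0.
  under eq_bigr do rewrite mulrBr.
  by rewrite sumrB -prob_indicator -mulr_suml w1 mul1r subrr.
have s01 : 0 <= s <= 1.
  rewrite sumr_ge0 //= -w1 [leRHS](bigID E) /= lerDl sumr_ge0 //.
have Ea2 : \sum_x w x * (a x * a x) <= 1.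
  rewrite -w1; apply: ler_sum => x _; rewrite ler_piMr // /a.
  by case: (E x) => /=; nra.
have cov (i j : 'I_k) :
    \sum_f P f * (a (f i) * a (f j)) <= (i == j)%:R.
  pose g q x : R := (if q == i then a x else 1) * (if q == j then a x else 1).
  have -> : \sum_f P f * (a (f i) * a (f j)) = \prod_q \sum_x w x * g q x.
    rewrite -product_expectation; apply: eq_bigr => f _; congr (_ * _).
    rewrite /g big_split /= -!big_mkcond /= !big_pred1_eq //.
  rewrite (bigD1 i) //= /g.
  case: (eqVneq i j) => [<-|ij].
    rewrite [X in _ * X]big1 ?mulr1 ?eqxx // => q /negbTE ->.
    by under eq_bigr do rewrite !mulr1; rewrite w1.
  rewrite eqxx; by under eq_bigr do rewrite mulr1; rewrite Ea mul0r.
have freq (f : {ffun 'I_k -> T}) :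
    #|[set q | E (f q)]|%:R / k%:R - s = (\sum_q a (f q)) / k%:R.
  rewrite sumrB sumr_const card_ord -[s *+ k]mulr_natr -natr_sum mulrBl.
  rewrite mulfK ?gt_eqF //; congr (_%:R / _ - _).
  by rewrite -sum1_card big_mkcond; apply: eq_bigr => q _; rewrite inE; case: (E _).
have var : \sum_f P f * (\sum_q a (f q)) ^+ 2 <= k%:R.
  apply: (@le_trans _ _ (\sum_i \sum_j \sum_f P f * (a (f i) * a (f j)))).
    rewrite le_eqVlt; apply/orP; left; apply/eqP.
    under [RHS]eq_bigr do rewrite exchange_big /=.
    rewrite [RHS]exchange_big /=; apply: eq_bigr => f _.
    rewrite expr2 mulr_suml mulr_sumr; apply: eq_bigr => i _.
    by rewrite mulr_sumr mulr_sumr.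
  apply: (@le_trans _ _ (\sum_(i < k) 1)); last by rewrite sumr_const card_ord.
  apply: ler_sum => i _; apply: le_trans (ler_sum _ (fun j _ => cov i j)) _.
  rewrite (bigD1 i) //= eqxx big1 ?addr0 // => j.
  by rewrite eq_sym => /negbTE ->.
have kt : 0 < k%:R * t by rewrite mulr_gt0.
rewrite prob_indicator.
have -> : (k%:R * t ^+ 2)^-1 = k%:R * ((k%:R * t) ^+ 2)^-1.
  by field; rewrite !gt_eqF.
rewrite ler_pdivlMr ?exprn_gt0 //.
apply: le_trans var; rewrite mulr_suml; apply: ler_sum => f _.
rewrite -mulrA; apply: ler_wpM2l => //.
rewrite freq; case: (boolP (t <= _)) => [tf|_]; last by rewrite mul0r sqr_ge0.
rewrite mul1r -[leRHS]real_normK ?num_real //.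
apply: lerXn2r; rewrite ?nnegrE ?normr_ge0 ?(ltW kt) //.
move: tf; rewrite normrM normfV [`|k%:R|]ger0_norm ?ler0n //.
by rewrite ler_pdivlMr // mulrC.
Qed.

End FiniteDistributions.

(** * Powers as mixtures of exponentials *)

Section PowerMixture.
Variable R : realType.

Lemma expR_half_le (x : R) : 1 <= x -> expR (- x) <= 2^-1.
Proof.
move=> x1; rewrite expRN lef_pV2 ?posrE ?expR_gt0 //.
by apply: le_trans (expR_ge1Dx x); lra.
Qed.

Lemma exp_decay (q d : R) : 0 < q < 1 -> 0 < d ->
  exists A, forall n, (A <= n)%N -> q ^+ n <= d.
Proof.
move=> /andP[q0 q1] d0; pose l := - ln q.
have l0 : 0 < l by rewrite oppr_gt0 ln_lt0 // q0.
exists (Num.trunc (l * d)^-1).+1 => n An.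
have nbig : (l * d)^-1 <= n%:R.
  by rewrite ltW // (lt_le_trans (truncnS_gt _)) // ler_nat.
rewrite -[q]lnK ?posrE // -expRM_natr -[ln q]opprK mulNr expRN -/l.
rewrite -[d]invrK lef_pV2 ?posrE ?expR_gt0 ?invr_gt0 //.
apply: le_trans (expR_ge1Dx _).
move: nbig; rewrite invfM mulrC ler_pdivrMr // mulrC; lra.
Qed.

Lemma geometric_bracket (b y : R) (r : nat) : 1 <= y < b ^+ r ->
  exists2 k, (k < r)%N & b ^+ k <= y < b ^+ k.+1.
Proof.
elim: r => [|r IH] /andP[y1 yb]; first by rewrite ltNge y1 in yb.
case: (ltP y (b ^+ r)) => [yr|ry]; last by exists r; rewrite ?ltnSn ?ry.
by have [|k kr kb] := IH; [rewrite y1|exists k => //; exact: ltnW].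
Qed.

(* With [b = beta ^ p] the sum [geo_mix] is almost homogeneous of degree [p]:
   multiplying [x] by [beta] shifts the summation index, which multiplies the
   sum by [b] up to its two end terms.  Its values at powers of [beta] are
   therefore almost proportional to those of [x ^ p], and monotonicity
   interpolates between them. *)
Definition geo_mix (b beta sigma : R) (m : nat) (x : R) : R :=
  \sum_(i < m) b ^- i * (1 - expR (- (beta ^+ i * sigma * x))).

Lemma geo_mix_homo (b beta sigma : R) (m : nat) :
  1 < b -> 1 < beta -> 0 <= sigma ->
  {homo geo_mix b beta sigma m : x y / x <= y}.
Proof.
move=> b1 beta1 sigma0 x y xy; apply: ler_sum => i _; apply: ler_wpM2l.
  by rewrite invr_ge0 exprn_ge0 //; lra.
rewrite lerD2l lerN2 ler_expR lerN2 ler_wpM2l // mulr_ge0 // exprn_ge0 //; lra.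
Qed.

(** The shifted sum gains the term of index [m], at most [b ^- m], and loses the term of index 0, at
    most [sigma * x] because [1 - exp(-u) <= u]. *)
Lemma geo_mix_scale (b beta sigma : R) (m : nat) (x : R) :
  1 < b -> 1 < beta -> 0 <= sigma -> 0 <= x ->
  `|geo_mix b beta sigma m (beta * x)
    - b * geo_mix b beta sigma m x|
    <= b * (b ^- m + sigma * x).
Proof.
move=> b1 beta1 sigma0 x0; pose t i : R := 1 - expR (- (beta ^+ i * sigma * x)).
have b0 : b != 0 by rewrite gt_eqF //; lra.
have t01 i : 0 <= t i <= 1.
  rewrite /t gerBl expR_ge0 andbT subr_ge0 expR_le1 oppr_le0 !mulr_ge0 //.
  by rewrite exprn_ge0 //; lra.
have -> : geo_mix b beta sigma m (beta * x)
    = b * \sum_(i < m) b ^- i.+1 * t i.+1.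
  rewrite mulr_sumr; apply: eq_bigr => i _; rewrite [RHS]mulrA.
  rewrite [b ^+ _.+1]exprS [(b * _)^-1]invfM mulVKf // /t exprS.
  by congr (_ * (1 - expR (- _))); ring.
have -> : \sum_(i < m) b ^- i.+1 * t i.+1
    = geo_mix b beta sigma m x + b ^- m * t m - t 0%N.
  apply/eqP; rewrite eq_sym subr_eq.
  rewrite -[geo_mix b beta sigma m x]/(\sum_(i < m) b ^- i * t i).
  have -> : \sum_(i < m) b ^- i * t i + b ^- m * t m
      = \sum_(i < m.+1) b ^- i * t i by rewrite big_ord_recr.
  by rewrite big_ord_recl expr0 invr1 mul1r addrC.
have -> : b * (geo_mix b beta sigma m x + b ^- m * t m - t 0%N)
    - b * geo_mix b beta sigma m x
  = b * (b ^- m * t m - t 0%N) by ring.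
have b0' : 0 <= b by lra.
rewrite normrM (ger0_norm b0') ler_wpM2l //.
have t0 : t 0%N <= sigma * x.
  by rewrite /t expr0 mul1r lerBlDr -lerBlDl expR_ge1Dx.
have bm0 : 0 <= b ^- m by rewrite invr_ge0 exprn_ge0.
have bmt : 0 <= b ^- m * t m <= b ^- m.
  by case/andP: (t01 m) => tm0 tm1; rewrite mulr_ge0 //= ler_piMr.
have sx : 0 <= sigma * x by rewrite mulr_ge0.
case/andP: (t01 0%N) => t00 _; case/andP: bmt => u0 u1.
by rewrite ler_norml; apply/andP; split; lra.
Qed.

(** Induction on [r] accumulates one scaling error per factor [beta]; the fixed [s] bounds all
    intermediate arguments at once. *)
Lemma geo_mix_power (b beta sigma : R) (m r s : nat) :
  1 < b -> 1 < beta -> 0 <= sigma -> (r <= s)%N ->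
  `|geo_mix b beta sigma m (beta ^+ r)
    - b ^+ r * geo_mix b beta sigma m 1|
    <= r%:R * b ^+ r * (b ^- m + sigma * beta ^+ s).
Proof.
move=> b1 beta1 sigma0; set mx := geo_mix _ _ _ _.
have beta0 : 0 <= beta by lra.
have b0 : 0 <= b by lra.
elim: r => [|r IH] rs; first by rewrite !expr0 !mul1r subrr normr0 !mul0r.
set tau := b ^- m + _.
have tau0 : 0 <= tau.
  by rewrite addr_ge0 ?invr_ge0 ?mulr_ge0 ?exprn_ge0.
rewrite !exprS; have -> : mx (beta * beta ^+ r) - b * b ^+ r * mx 1 =
  (mx (beta * beta ^+ r) - b * mx (beta ^+ r))
  + b * (mx (beta ^+ r) - b ^+ r * mx 1) by ring.
apply: le_trans (ler_normD _ _) _.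
have -> : r.+1%:R * (b * b ^+ r) * tau
    = b * b ^+ r * tau + b * (r%:R * b ^+ r * tau).
  by rewrite -natr1; ring.
apply: lerD; last first.
  by rewrite normrM (ger0_norm b0) ler_wpM2l // IH // ltnW.
apply: le_trans (geo_mix_scale _ b1 beta1 sigma0 (exprn_ge0 _ beta0)) _.
rewrite -mulrA ler_wpM2l //.
apply: (@le_trans _ _ tau).
  by rewrite lerD2l ler_wpM2l // ler_eXn2l // ltnW.
by rewrite ler_peMl // exprn_ege1 // ltW.
Qed.

Lemma powR_le_nat (p : R) (x : nat) : 0 < p < 1 -> x%:R `^ p <= x%:R :> R.
Proof.
case/andP=> p0 p1; case: x => [|x]; first by rewrite powR0 // gt_eqF.
by rewrite ler1_powR ?ler1n // ltW.
Qed.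

(** The mixture is [geo_mix] divided by its value at 1. The lower bound [Z] on the total weight will
    make a single test unlikely to hit anyone. *)
Lemma power_mixture (p : R) (N : nat) (h Z : R) : 0 < p < 1 -> 0 < h ->
  exists m (w s : nat -> R),
  [/\ forall i, 0 <= w i, forall i, 0 <= s i, Z <= \sum_(i < m) w i &
      forall x, (x <= N)%N ->
      `|\sum_(i < m) w i * (1 - expR (- (s i * x%:R))) - x%:R `^ p| <= h].
Proof.
move=> hp h0; case/andP: (hp) => p0 p1.
have N0 : 0 < N.+1%:R :> R by rewrite ltr0n.
(* Consecutive powers of [b] in the relevant range then differ by at most [h / 2]; the other half is
   left for the error at the grid points. *)
pose h1 := h / (2 * N.+1%:R).
have h1h : N.+1%:R * h1 = h / 2.
  by rewrite /h1; move: N.+1%:R N0 => y y0; field; rewrite gt_eqF.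
have h10 : 0 < h1 by rewrite divr_gt0 // mulr_gt0.
pose b := 1 + h1; pose beta := b `^ p^-1.
have b1 : 1 < b by rewrite /b; lra.
have b0 : 0 < b by lra.
(* Here [p < 1] matters: it gives [b < beta], so that [(b / beta) ^+ A] tends to 0. *)
have betaE : beta = b * b `^ (p^-1 - 1).
  by rewrite mulr_powRB1 ?ltW // invr_gt0.
have bb1 : 1 < b `^ (p^-1 - 1).
  rewrite -[ltLHS](powRr0 b) /powR gt_eqF // ltr_expR ltr_pM2r ?ln_gt0 //.
  by rewrite subr_gt0 invf_gt1.
have beta1 : 1 < beta by rewrite betaE mulr_egt1.
have beta0 : 0 < beta by lra.
have betap k : (beta ^+ k) `^ p = b ^+ k.
  rewrite -powR_mulrn ?powR_ge0 // /beta -(powRrM b) -(powRrM b).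
  rewrite [_ * p]mulrAC mulVf ?gt_eqF //.
  by rewrite mul1r powR_mulrn // ltW.
have [S HS] : exists S, N.+1%:R <= beta ^+ S.
  have [||A HA] := @exp_decay beta^-1 N.+1%:R^-1.
  - by rewrite invr_gt0 beta0 invf_lt1.
  - by rewrite invr_gt0.
  exists A; have := HA A (leqnn _).
  by rewrite exprVn lef_pV2 ?posrE // exprn_gt0.
(* [c1 / 2] bounds the factor [r * b ^+ r] of [geo_mix_power] for [r <= S], and [d] is chosen so
   that [c1 * (d + d * beta ^+ S) <= h / 4]. *)
pose c1 : R := 2 * S%:R * b ^+ S.
have c10 : 0 <= c1 by rewrite !mulr_ge0 // exprn_ge0 // ltW.
pose d := h / 4 / (c1 * beta ^+ S + c1 + 1).
have den0 : 0 < c1 * beta ^+ S + c1 + 1.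
  by rewrite ltr_wpDl // addr_ge0 // mulr_ge0 // exprn_ge0 // ltW.
have d0 : 0 < d by rewrite !divr_gt0.
have [||A1 HA1] := @exp_decay b^-1 d; [|by []|].
  by rewrite invr_gt0 b0 invf_lt1.
have [||A2 HA2] := @exp_decay (b / beta) d; [|by []|].
  rewrite divr_gt0 //= ltr_pdivrMr // mul1r betaE -[ltLHS]mulr1 ltr_pM2l //.
(* The scale at the middle index [A] is 1, whence [g 1 >= b ^- A / 2]. Relative to [b ^- A], the two
   end errors are at most [d] and [d * beta ^+ S]. *)
pose A := maxn A1 A2; pose m := (A + A).+1; pose sigma := beta ^- A.
have HdA1 : b ^- A <= d by rewrite -exprVn HA1 // leq_maxl.
have HdA2 : b ^+ A * sigma <= d.
  by rewrite /sigma -exprVn -exprMn HA2 // leq_maxr.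
have sigma0 : 0 <= sigma by rewrite invr_ge0 exprn_ge0 // ltW.
pose g := geo_mix b beta sigma m.
have g1 : b ^- A / 2 <= g 1.
  have Am : (A < m)%N by rewrite ltnS leq_addr.
  rewrite /g /geo_mix (bigD1 (Ordinal Am)) //= -[leLHS]addr0; apply: lerD.
    rewrite ler_wpM2l ?invr_ge0 ?exprn_ge0 ?(ltW b0) //.
    rewrite mulr1 mulfV ?gt_eqF ?exprn_gt0 //.
    by have := @expR_half_le 1 (lexx _); lra.
  apply: sumr_ge0 => i _;
    rewrite mulr_ge0 ?invr_ge0 ?exprn_ge0 ?(ltW b0) //.
  rewrite subr_ge0 expR_le1 oppr_le0 !mulr_ge0 // exprn_ge0 // ltW //.
have bA0 : 0 < b ^- A by rewrite invr_gt0 exprn_gt0.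
have g10 : 0 < g 1 by apply: lt_le_trans g1; rewrite divr_gt0.
have gpow r : (r <= S)%N -> `|g (beta ^+ r) / g 1 - b ^+ r| <= h / 2.
  move=> rS; have -> : g (beta ^+ r) / g 1 - b ^+ r
    = (g (beta ^+ r) - b ^+ r * g 1) / g 1 by field; rewrite gt_eqF.
  rewrite normrM normfV (gtr0_norm g10) ler_pdivrMr //.
  apply: le_trans (geo_mix_power _ b1 beta1 sigma0 rS) _.
  apply: (@le_trans _ _ (h / 2 * (b ^- A / 2))); last first.
    by apply: ler_wpM2l => //; rewrite divr_ge0 ?ltW.
  set tau := _ + _.
  have tau0 : 0 <= tau.
    by rewrite addr_ge0 ?mulr_ge0 ?invr_ge0 ?exprn_ge0 ?(ltW b0) ?(ltW beta0).
  apply: (@le_trans _ _ (c1 / 2 * tau)).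
    apply: ler_wpM2r => //; rewrite /c1.
    have -> : 2 * S%:R * b ^+ S / 2 = S%:R * b ^+ S by field.
    by apply: ler_pM; rewrite ?ler_nat ?exprn_ge0 ?ler_eXn2l // ltW.
  have : b ^+ A * tau <= d + d * beta ^+ S.
    rewrite mulrDr; apply: lerD; last first.
      by rewrite mulrA ler_wpM2r // exprn_ge0 // ltW.
    apply: le_trans HdA1; rewrite /m -addnS exprD invfM mulrA mulfV; last first.
      by rewrite gt_eqF // exprn_gt0.
    by rewrite mul1r lef_pV2 ?posrE ?exprn_gt0 // ler_eXn2l.
  move=> H; have -> : c1 / 2 * tau = c1 / 2 * (b ^+ A * tau) * b ^- A.
    by field; rewrite gt_eqF // exprn_gt0.
  have -> : h / 2 * (b ^- A / 2) = h / 4 * b ^- A.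
    by move: (b ^- A) => z; field.
  apply: ler_wpM2r; first exact: ltW.
  have : c1 * (b ^+ A * tau) <= c1 * (d + d * beta ^+ S) by apply: ler_wpM2l.
  have : d * (c1 * beta ^+ S + c1 + 1) = h / 4.
    by rewrite /d divfK // gt_eqF.
  lra.
(* The extra last term has scale 0: it adds nothing to the mixture but lifts the total weight to at
   least [Z]. *)
pose w i := if (i < m)%N then b ^- i / g 1 else `|Z|.
pose s i := if (i < m)%N then beta ^+ i * sigma else 0.
have w0 i : 0 <= w i.
  rewrite /w; case: ifP => // _.
  by rewrite divr_ge0 ?invr_ge0 ?exprn_ge0 ?(ltW b0) ?(ltW g10).
exists m.+1, w, s; split => //.
- by move=> i; rewrite /s; case: ifP => // _; rewrite mulr_ge0 ?exprn_ge0 ?(ltW beta0).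
- rewrite big_ord_recr /= {2}/w ltnn; apply: le_trans (ler_norm _) _.
  by rewrite lerDr sumr_ge0.
move=> x xN; rewrite big_ord_recr /= {2}/s ltnn.
rewrite mul0r oppr0 expR0 subrr mulr0 addr0.
have -> : \sum_(i < m) w i * (1 - expR (- (s i * x%:R))) = g x%:R / g 1.
  rewrite mulr_suml; apply: eq_bigr => i _; rewrite /w /s ltn_ord.
  by rewrite mulrAC.
case: (posnP x) => [->|x0].
  rewrite powR0 ?gt_eqF // subr0 /g /geo_mix.
  rewrite big1 ?mul0r ?normr0 ?ltW // => i _.
  by rewrite mulr0 oppr0 expR0 subrr mulr0.
have x1 : 1 <= x%:R :> R by rewrite ler1n.
have [|r rS /andP[bx xb]] := @geometric_bracket beta x%:R S.
  by rewrite x1 (lt_le_trans _ HS) // ltr_nat ltnS.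
have gx : g (beta ^+ r) / g 1 <= g x%:R / g 1 <= g (beta ^+ r.+1) / g 1.
  by rewrite !ler_pM2r ?invr_gt0 // !geo_mix_homo // ltW.
have xp : b ^+ r <= x%:R `^ p <= b ^+ r.+1.
  rewrite -!betap; apply/andP; split;
    by apply: ge0_ler_powR; rewrite ?nnegrE ?exprn_ge0 // ltW.
have gap : b ^+ r.+1 <= b ^+ r + h / 2.
  rewrite exprS /b mulrDl mul1r lerD2l -h1h mulrC.
  apply: ler_wpM2r; first exact: ltW.
  case/andP: xp => xp _; apply: le_trans xp _.
  apply: le_trans (powR_le_nat _ hp) _.
  by rewrite ler_nat ltnW.
case/andP: gx => gx1 gx2; case/andP: xp => xp1 xp2.
move: (gpow r (ltnW rS)) (gpow _ rS); rewrite !ler_norml.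
move=> /andP[g1l g1r] /andP[g2l g2r].
by apply/andP; split; lra.
Qed.

End PowerMixture.

(** * The level sketch *)

Section LevelSketch.
Variable R : realType.

Lemma norm_subX (a b : R) (t : nat) : 0 <= a <= 1 -> 0 <= b <= 1 ->
  `|a ^+ t - b ^+ t| <= t%:R * `|a - b|.
Proof.
move=> /andP[a0 a1] /andP[b0 b1].
rewrite subrXX normrM mulrC; apply: ler_wpM2r => //.
apply: le_trans (ler_norm_sum _ _ _) _.
have -> : t%:R = \sum_(i < t) 1 :> R by rewrite sumr_const card_ord.
apply: ler_sum => i _; rewrite ger0_norm ?mulr_ge0 ?exprn_ge0 //.
by rewrite mulr_ile1 ?exprn_ge0 ?exprn_ile1.
Qed.

Lemma norm_expRB (a b : R) : 0 <= a -> 0 <= b ->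
  `|expR (- a) - expR (- b)| <= `|a - b|.
Proof.
wlog ab : a b / a <= b => [H a0 b0|a0 b0].
  case: (leP a b) => [|/ltW] ab; first exact: H.
  by rewrite distrC [leRHS]distrC H.
have -> : expR (- b) = expR (- a) * expR (a - b).
  by rewrite -expRD; congr expR; ring.
rewrite -[X in X - _]mulr1 -mulrBr normrM ger0_norm ?expR_ge0 //.
have e1 : expR (a - b) <= 1 by rewrite expR_le1 subr_le0.
rewrite (ler0_norm (x := a - b)) ?subr_le0 // ger0_norm ?subr_ge0 //.
have e2 : 1 - expR (a - b) <= - (a - b).
  by have := expR_ge1Dx (a - b); lra.
apply: le_trans e2; rewrite ler_piMl ?subr_ge0 //.
by rewrite expR_le1 oppr_le0.
Qed.

Lemma expR_quadratic (g : R) : 0 <= g -> `|1 - g - expR (- g)| <= g ^+ 2.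
Proof.
move=> g0; have e1 := expR_ge1Dx (- g).
have e2 : expR (- g) <= 1 - g + g ^+ 2.
  rewrite expRN; apply: (@le_trans _ _ (1 + g)^-1).
    by rewrite lef_pV2 ?posrE ?expR_gt0 ?expR_ge1Dx //; lra.
  rewrite -div1r ler_pdivrMr; last by lra.
  have g3 : 0 <= g ^+ 3 by rewrite exprn_ge0.
  have -> : (1 - g + g ^+ 2) * (1 + g) = 1 + g ^+ 3 by ring.
  by rewrite lerDl.
by rewrite ler_norml; apply/andP; split; lra.
Qed.

Lemma find_iota_gt (P : pred nat) (B l : nat) : (l < B)%N ->
    (forall i, (i <= l)%N -> P i -> P l) ->
  (l < find P (iota 0 B))%N = ~~ P l.
Proof.
move=> lB Pmono; apply/idP/idP => [lf|nPl].
  by have := before_find 0%N lf; rewrite nth_iota // add0n => ->.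
rewrite ltnNge; apply: contra nPl => fl.
have fB : (find P (iota 0 B) < B)%N by apply: leq_ltn_trans lB.
have hP : has P (iota 0 B) by rewrite has_find size_iota.
have := nth_find 0%N hP; rewrite nth_iota // add0n; exact: Pmono.
Qed.

Lemma joint_distribution (S T : finType) (w : S -> R) (k : S -> T -> R) :
  distribution w -> (forall x, distribution (k x)) ->
  distribution (fun a : S * T => w a.1 * k a.1 a.2).
Proof.
move=> [w0 w1] kd; split=> [a|]; first by rewrite mulr_ge0 //; case: (kd a.1).
rewrite -(pair_bigA _ (fun x y => w x * k x y)) /= -w1.
apply: eq_bigr => x _; rewrite -mulr_sumr; case: (kd x) => _ ->.
by rewrite mulr1.
Qed.

Lemma joint_prob (S T : finType) (w : S -> R) (k : S -> T -> R)
    (E : pred (S * T)) :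
  prob (fun a : S * T => w a.1 * k a.1 a.2) E
  = \sum_x w x * prob (k x) (fun y => E (x, y)).
Proof.
rewrite prob_indicator; under [RHS]eq_bigr do rewrite prob_indicator mulr_sumr.
by rewrite pair_bigA; apply: eq_bigr => -[x y] _ /=; rewrite mulrA.
Qed.

End LevelSketch.

(** * Random tests and their hitting probability *)

Section Tests.
Variables (R : realType) (n M : nat) (V : finType) (m : nat).
Variables (w s : 'I_m -> R).
Hypotheses (w_ge0 : forall i, 0 <= w i) (s_ge0 : forall i, 0 <= s i).
Hypotheses (W_gt0 : 0 < \sum_i w i) (n_gt0 : (0 < n)%N).

(* The bit at [(v, x)] tells whether player [v] is hit when its entry at the
   tested coordinate is [x]. *)
Definition test : finType :=
  (('I_n * 'I_m) * {ffun V * 'I_M.+1 -> bool})%type.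

Definition hit (v : V) (x : {ffun 'I_n -> 'I_M.+1}) (a : test) : bool :=
  a.2 (v, x a.1.1).

Definition hit_weight (i : 'I_m) (c : V * 'I_M.+1) (b : bool) : R :=
  if b then 1 - expR (- (s i * c.2%:R)) else expR (- (s i * c.2%:R)).

Definition place_weight (a : 'I_n * 'I_m) : R :=
  w a.2 / (n%:R * \sum_i w i).

Definition test_weight (a : test) : R :=
  place_weight a.1 * product_weight (hit_weight a.1.2) a.2.

Definition scale_mixture (x : R) : R := \sum_i w i * (1 - expR (- (s i * x))).

Lemma nW_gt0 : 0 < n%:R * \sum_i w i.
Proof. by rewrite mulr_gt0 // ltr0n. Qed.

Lemma place_distribution : distribution place_weight.
Proof.
split=> [a|]; first by rewrite divr_ge0 // ltW // nW_gt0.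
rewrite -mulr_suml -(pair_bigA _ (fun _ i => w i)) /= sumr_const card_ord.
by rewrite -[_ *+ n]mulr_natl divff // gt_eqF // nW_gt0.
Qed.

Lemma hit_distribution (i : 'I_m) (c : V * 'I_M.+1) :
  distribution (hit_weight i c).
Proof.
split=> [[]|]; last by rewrite big_bool /= subrK.
  by rewrite subr_ge0 expR_le1 oppr_le0 mulr_ge0.
by rewrite expR_ge0.
Qed.

Lemma test_distribution : distribution test_weight.
Proof.
apply: (@joint_distribution _ _ _ place_weight
  (fun a => product_weight (hit_weight a.2))).
  exact: place_distribution.
by move=> a; apply: product_distribution => c; apply: hit_distribution.
Qed.

(** For a fixed coordinate and scale the players are missed independently, and the product of their
    exponentials depends only on the sum of their entries. *)
Lemma prob_no_hit (X : V -> {ffun 'I_n -> 'I_M.+1}) :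
  prob test_weight (fun a => [forall v, ~~ hit v (X v) a])
  = 1 - (\sum_j scale_mixture (sum_vector R X j)) / (n%:R * \sum_i w i).
Proof.
rewrite (@joint_prob _ _ _ place_weight
  (fun a => product_weight (hit_weight a.2))).
have miss (a : 'I_n * 'I_m) : prob (product_weight (hit_weight a.2))
    (fun b => [forall v, ~~ hit v (X v) (a, b)])
    = expR (- (s a.2 * sum_vector R X a.1)).
  (* Stated as a condition on every bit, the event is a product event; bits at values other than
     [X v a.1] are free and contribute a factor 1. *)
  pose E (c : V * 'I_M.+1) (b : bool) := (c.2 == X c.1 a.1) ==> ~~ b.
  rewrite (@eq_prob _ _ _ _
    (fun b : {ffun V * 'I_M.+1 -> bool} => [forall c, E c (b c)])); last first.
    move=> b; apply/forallP/forallP => [H [v x]|H v].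
      by rewrite /E /=; apply/implyP => /eqP ->; apply: H.
    by have := H (v, X v a.1); rewrite /E /= eqxx.
  rewrite product_prob.
  transitivity (\prod_(v : V) expR (- (s a.2 * (X v a.1)%:R))); last first.
    rewrite -expR_sum; congr expR; rewrite sumrN -mulr_sumr.
    by rewrite /sum_vector natr_sum.
  rewrite -(pair_bigA _ (fun v x => prob (hit_weight a.2 (v, x)) (E (v, x)))) /=.
  apply: eq_bigr => v _; rewrite (bigD1 (X v a.1)) //= big1 ?mulr1.
    rewrite prob_indicator big_bool /E /= eqxx /=.
    by rewrite mulr0 mulr1 add0r.
  move=> x xX; rewrite prob_indicator big_bool /E /= (negbTE xX) /=.
  by rewrite !mulr1 subrK.
under eq_bigr do rewrite miss.
case: place_distribution => _ p1; rewrite -[X in X - _]p1 mulr_suml.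
apply/eqP; rewrite eq_sym subr_eq addrC -subr_eq -sumrB; apply/eqP.
rewrite -(pair_bigA _ (fun j i => place_weight (j, i)
  - place_weight (j, i) * expR (- (s i * sum_vector R X j)))) /=.
apply: eq_bigr => j _; rewrite /scale_mixture mulr_suml; apply: eq_bigr => i _.
by rewrite /place_weight /=; ring.
Qed.

End Tests.

(** * Survival probabilities of the levels *)

Section Sketch.
Variable R : realType.

Lemma card_sum_vector_le (n M : nat) (V : finType)
    (X : V -> {ffun 'I_n -> 'I_M.+1}) (j : 'I_n) :
  (\sum_(v : V) X v j <= #|V| * M)%N.
Proof.
by rewrite -sum_nat_const; apply: leq_sum => v _; rewrite -ltnS ltn_ord.
Qed.

Lemma Fp_ge0 (p : R) (n : nat) (x : 'I_n -> R) : 0 <= Fp p x.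
Proof. by apply: sumr_ge0 => j _; apply: powR_ge0. Qed.

(** The three errors come, in order, from replacing [1 - g] by [exp(-g)] in each test, from rounding
    the number of tests down, and from [c * g] differing from [F]. *)
Lemma no_hit_approx (g F lam c : R) : 0 <= g <= 1 -> 0 < c -> 0 <= lam ->
    0 <= F ->
  `|(1 - g) ^+ Num.trunc (lam * c) - expR (- (lam * F))|
    <= lam * c * g ^+ 2 + g + lam * `|c * g - F|.
Proof.
move=> /andP[g0 g1] c0 lam0 F0; set t := Num.trunc _.
have lc0 : 0 <= lam * c by rewrite mulr_ge0 // ltW.
have tle : t%:R <= lam * c by rewrite truncn_le.
have tgt : lam * c < t%:R + 1 by rewrite natr1 truncnS_gt.
have -> : (1 - g) ^+ t - expR (- (lam * F)) = ((1 - g) ^+ t - expR (- g) ^+ t)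
  + (expR (- (g * t%:R)) - expR (- (lam * F))).
  by rewrite -(mulNr g) expRM_natr; ring.
apply: le_trans (ler_normD _ _) _; rewrite -addrA; apply: lerD.
  apply: (@le_trans _ _ (t%:R * `|1 - g - expR (- g)|)).
    apply: norm_subX; first by apply/andP; split; lra.
    by rewrite expR_ge0 expR_le1 oppr_le0.
  by apply: ler_pM => //; exact: expR_quadratic.
apply: le_trans (norm_expRB _ _) _; rewrite ?mulr_ge0 //.
have -> : g * t%:R - lam * F = - (g * (lam * c - t%:R)) + lam * (c * g - F).
  by ring.
apply: le_trans (ler_normD _ _) _; apply: lerD.
  rewrite normrN ger0_norm; last by rewrite mulr_ge0 // subr_ge0.
  by rewrite ler_piMr //; lra.
by rewrite normrM (ger0_norm lam0).
Qed.

(** All levels read prefixes of one sequence of tests, so a hit persists to higher levels and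
    survival is a power of the one-test probability. Level [B] means no hit at any level below
    [B]. *)
Lemma level_sketch (p : R) (n M B : nat) (V : finType) (lam : nat -> R)
    (d : R) :
    0 < p < 1 -> (0 < n)%N -> 0 < d -> (forall l, 0 <= lam l) ->
    {homo lam : i j / (i <= j)%N >-> i <= j} ->
  exists (T : finType) (w : T -> R)
      (lev : V -> {ffun 'I_n -> 'I_M.+1} -> T -> 'I_B.+1),
    distribution w /\
    forall X l, (l < B)%N ->
    `|prob w (fun o => [forall v, (l < lev v (X v) o)%N])
      - expR (- (lam l * Fp p (sum_vector R X)))| <= d.
Proof.
move=> hp n0 d0 lam0 lam_homo.
pose N := (#|V| * M)%N; pose L := lam B.
have L0 : 0 <= L by exact: lam0.
have n0' : 0 < n%:R :> R by rewrite ltr0n.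
have Ln0 : 0 <= L * n%:R by rewrite mulr_ge0.
(* Half of [d] pays for the mixture error [L * n * h]; the summand [d] in the denominator ensures
   [h <= 1]. *)
pose h := d / 2 / (L * n%:R + d).
have h0 : 0 < h by rewrite !divr_gt0 //; lra.
have hE : h * (L * n%:R + d) = d / 2 by rewrite divfK // gt_eqF //; lra.
have h1 : h <= 1.
  rewrite ler_pdivrMr; last by lra.
  by lra.
have Lnh : L * n%:R * h <= d / 2 by nra.
pose Y := (N.+1%:R : R); have Y1 : 1 <= Y by rewrite ler1n.
(* [K / Z] bounds the first two errors of [no_hit_approx], through [u <= n * Y] and [g * Z <= Y];
   [Z] makes this at most [d / 2]. *)
pose K := (L * n%:R * Y + 1) * Y.
have K0 : 1 <= K by rewrite /K; nra.
pose Z := K / (d / 2) + Y.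
have KZ : K <= d / 2 * Z.
  have : d / 2 * (K / (d / 2)) = K by rewrite mulrC divfK // gt_eqF // divr_gt0.
  by rewrite /Z mulrDr; nra.
have [m [w [s [w0 s0 WZ approx]]]] := power_mixture N Z hp h0.
set W := \sum_(i < m) w i in WZ.
have Z0 : 0 < Z by rewrite ltr_wpDl ?divr_ge0 //; lra.
have W0 : 0 < W by lra.
pose wi (i : 'I_m) := w i; pose si (i : 'I_m) := s i.
have wi0 i : 0 <= wi i by exact: w0.
have si0 i : 0 <= si i by exact: s0.
pose t l := Num.trunc (lam l * (n%:R * W)).
have nW0 : 0 < n%:R * W by rewrite mulr_gt0.
have t_homo i j : (i <= j)%N -> (t i <= t j)%N.
  by move=> ij; apply: le_truncn; rewrite ler_pM2r // lam_homo.
pose T : finType := {ffun 'I_(t B) -> test n M V m}.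
pose P v x (o : T) l := [exists tau : 'I_(t B), (tau < t l)%N && hit v x (o tau)].
have P_homo v x o i j : (i <= j)%N -> P v x o i -> P v x o j.
  move=> ij /existsP[tau /andP[ti ht]]; apply/existsP; exists tau.
  by rewrite ht (leq_trans ti) // t_homo.
pose lev v x (o : T) : 'I_B.+1 := inord (find (P v x o) (iota 0 B)).
have levE v x o l : (l < B)%N -> (l < lev v x o)%N = ~~ P v x o l.
  move=> lB; rewrite inordK.
    by apply: find_iota_gt => // i il; exact: P_homo.
  by rewrite ltnS -[leqRHS](size_iota 0 B) find_size.
exists T, (product_weight (fun _ => test_weight wi si)), lev; split.
  by apply: product_distribution => _; exact: test_distribution.
move=> X l lB; set F := Fp _ _.
rewrite (@eq_prob _ _ _ _ (fun o : T =>
  [forall tau : 'I_(t B), (tau < t l)%N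
    ==> [forall v, ~~ hit v (X v) (o tau)]])); last first.
  move=> o; apply/forallP/forallP => [H tau|H v].
    apply/implyP => tl; apply/forallP => v; have := H v; rewrite levE //.
    by move/existsPn => /(_ tau); rewrite tl.
  rewrite levE //; apply/existsPn => tau; apply/negP => /andP[tl ht].
  by have := H tau; rewrite tl => /forallP /(_ v); rewrite ht.
rewrite (@product_prob _ _ _ _ (fun (tau : 'I_(t B)) a =>
  (tau < t l)%N ==> [forall v, ~~ hit v (X v) a])).
have tdist : distribution (test_weight (V := V) wi si : test n M V m -> R).
  exact: test_distribution.
pose q := prob (test_weight wi si) (fun a => [forall v, ~~ hit v (X v) a]).
have -> : \prod_(tau < t B) prob (test_weight wi si) (fun a =>
    (tau < t l)%N ==> [forall v, ~~ hit v (X v) a]) = q ^+ t l.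
  transitivity (\prod_(tau < t B | (tau < t l)%N) q).
    rewrite [RHS]big_mkcond; apply: eq_bigr => tau _.
    by case: ifP => //= _; case: tdist.
  rewrite -(big_ord_widen (t B) (fun=> q)) ?prodr_const ?card_ord //.
  by rewrite t_homo // ltnW.
pose u := \sum_j scale_mixture wi si (sum_vector R X j).
have qE : q = 1 - u / (n%:R * W) by rewrite /q prob_no_hit.
pose g := u / (n%:R * W); rewrite qE -/g.
have sumX j : sum_vector R X j = (\sum_v X v j)%N%:R by [].
have mixF j : `|scale_mixture wi si (sum_vector R X j)
    - `|sum_vector R X j| `^ p| <= h.
  rewrite sumX [`|_%:R|]ger0_norm //; exact: approx (card_sum_vector_le X j).
have uF : `|u - F| <= n%:R * h.
  rewrite /u /F /Fp -sumrB; apply: le_trans (ler_norm_sum _ _ _) _.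
  apply: le_trans (ler_sum _ (fun j _ => mixF j)) _.
  by rewrite sumr_const card_ord mulr_natl.
have uY : u <= n%:R * Y.
  rewrite mulr_natl -[n in _ *+ n]card_ord -sumr_const; apply: ler_sum => j _.
  have := mixF j; rewrite ler_norml => /andP[_].
  have : `|sum_vector R X j| `^ p <= N%:R.
    rewrite sumX [`|_%:R|]ger0_norm //; apply: le_trans (powR_le_nat _ hp) _.
    by rewrite ler_nat card_sum_vector_le.
  rewrite /Y -natr1; lra.
have u0 : 0 <= u.
  apply: sumr_ge0 => j _; apply: sumr_ge0 => i _; rewrite mulr_ge0 //.
  by rewrite subr_ge0 expR_le1 oppr_le0 mulr_ge0.
have g0 : 0 <= g by rewrite divr_ge0 // ltW.
have g1 : g <= 1.
  have : 0 <= q by rewrite /q prob_indicator; apply: sumr_ge0 => a _;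
    rewrite mulr_ge0 //; case: tdist.
  by rewrite qE -/g; lra.
have F0 : 0 <= F by exact: Fp_ge0.
have cg : n%:R * W * g = u by rewrite mulrC divfK // gt_eqF.
have lamL : lam l <= L by apply: lam_homo; exact: ltnW.
apply: le_trans (no_hit_approx _ nW0 (lam0 l) F0) _; first by rewrite g0.
rewrite cg.
have gY : g * Z <= Y.
  rewrite /g mulrAC ler_pdivrMr //.
  have -> : Y * (n%:R * W) = n%:R * Y * W by ring.
  by apply: ler_pM => //; exact: ltW.
have E1 : lam l * (n%:R * W) * g ^+ 2 + g <= d / 2.
  have -> : lam l * (n%:R * W) * g ^+ 2 = lam l * (n%:R * W * g) * g by ring.
  rewrite cg -[X in _ + X]mul1r -mulrDl -(ler_pM2r Z0).
  apply: le_trans KZ; rewrite /K -(mulrA _ g Z).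
  apply: ler_pM => //; [by rewrite addr_ge0 // mulr_ge0| |].
    by rewrite mulr_ge0 // ltW.
  by rewrite lerD2r -mulrA; apply: ler_pM.
have E2 : lam l * `|u - F| <= d / 2.
  apply: le_trans Lnh; rewrite -mulrA; exact: ler_pM.
lra.
Qed.

End Sketch.

(** * Aggregation along a breadth-first tree *)

Section Distance.
Variables (V : finType) (e : rel V).

Lemma walkP (k : nat) (u v : V) :
  reflect (exists s, [/\ size s = k, path e u s & last u s = v]) (walk e k u v).
Proof.
apply: (iffP existsP) => [[s /andP[es /eqP ls]]|[s [sk es ls]]].
  by exists s; rewrite size_tuple.
have sk' : size s == k by apply/eqP.
by exists (Tuple sk') => /=; rewrite es ls eqxx.
Qed.

Lemma gdist_le (k : nat) (u v : V) : walk e k u v -> (gdist e u v <= k)%N.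
Proof.
move=> wk; case: (ltnP k #|V|) => [kV|Vk]; last first.
  by apply: leq_trans Vk; rewrite -[leqRHS](size_iota 0) find_size.
rewrite leqNgt; apply/negP => kd.
by have := before_find 0%N kd; rewrite nth_iota // add0n wk.
Qed.

(** A walk without repeated vertices has fewer than [#|V|] edges, so the search in [gdist]
    succeeds. *)
Lemma walk_gdist (u v : V) : connect e u v -> walk e (gdist e u v) u v.
Proof.
move=> /connectP[p ep vp]; case/shortenP: ep vp => q eq uq _ vq.
have qV : (size q < #|V|)%N.
  by have := max_card (mem (u :: q)); rewrite (card_uniqP uq).
have wq : walk e (size q) u v by apply/walkP; exists q.
have dq := gdist_le wq.
have dV : (gdist e u v < #|V|)%N by apply: leq_ltn_trans qV.
have := @nth_find _ 0%N (fun k => walk e k u v) (iota 0 #|V|).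
rewrite has_find size_iota nth_iota //; exact.
Qed.

Lemma gdist_refl (u : V) : gdist e u u = 0%N.
Proof. by apply/eqP; rewrite -leqn0 gdist_le //; apply/walkP; exists [::]. Qed.

Lemma gdist_predecessor (u v : V) : connected_graph e -> u != v ->
  exists2 w, e u w & (gdist e w v).+1 = gdist e u v.
Proof.
move=> conn uv; have /walkP[[|w s] [sd es ls]] := walk_gdist (conn u v).
  by rewrite -ls /= eqxx in uv.
case/andP: es => uw es; exists w => //; apply/eqP; rewrite eqn_leq.
rewrite -sd ltnS gdist_le /=; last by apply/walkP; exists s.
rewrite -[(size s).+1]/(size (w :: s)) sd gdist_le //.
have /walkP[q [sq eq lq]] := walk_gdist (conn w v).
by apply/walkP; exists (w :: q); rewrite /= uw eq sq.
Qed.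

Lemma gdist_le_diameter (u v : V) : (gdist e u v <= diameter e)%N.
Proof.
apply: leq_trans (leq_bigmax u).
exact: (@leq_bigmax _ (fun v => gdist e u v) v).
Qed.

End Distance.

(** Positive length keeps the empty string free to mean that nothing was sent. *)
Lemma fixed_length_code (A : finType) (len : nat) :
    (#|A| <= 2 ^ len)%N -> (0 < len)%N ->
  exists (enc : A -> seq bool) (dec : seq bool -> option A),
  [/\ forall a, size (enc a) = len, forall a, dec (enc a) = Some a
    & dec [::] = None].
Proof.
move=> Alen len0; have le : (#|A| <= #|{: len.-tuple bool}|)%N.
  by rewrite card_tuple card_bool.
pose enc (a : A) : seq bool := enum_val (widen_ord le (enum_rank a)).
have enc_inj : injective enc.
  move=> a b /val_inj /enum_val_inj /(congr1 val) /= ab.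
  exact/enum_rank_inj/val_inj.
have enc_size a : size (enc a) = len by rewrite size_tuple.
exists enc, (fun s => [pick a | enc a == s]); split=> // [a|].
  by case: pickP => [b /eqP /enc_inj ->//|/(_ a)]; rewrite eqxx.
case: pickP => // a /eqP /(congr1 size) /= sa.
by rewrite -(enc_size a) sa in len0.
Qed.

(** * The convergecast protocol and its cost *)

Section Convergecast.
Variables (V : finType) (e : rel V) (root : V) (I O : Type) (A : finType).
Variables (op : A -> A -> A) (enc : A -> seq bool).
Variables (dec : seq bool -> option A) (len L : nat).
Variables (own : V -> I -> L.-tuple bool -> A) (out : A -> O).

Definition depth (u : V) : nat := gdist e u root.

(** No neighbour of the root is closer to it, so the default makes the root its own parent. *)
Definition parent (u : V) : V :=
  odflt u [pick w | e u w && ((depth w).+1 == depth u)].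

Definition height : nat := (\max_(u : V) depth u)%N.

Definition absorb (b : inbox V) (w : V) (a : A) : A :=
  if dec (b w) is Some c then op c a else a.

Definition aggregate (a : A) (h : seq (inbox V)) : A :=
  foldr (fun b a => foldr (absorb b) a (enum V)) a h.

(* The players at depth [k] speak in round [height - k], after all their
   children have spoken. *)
Definition convergecast : protocol V I O :=
  @Protocol V I O L height
    (fun u x r h v =>
       if [&& v == parent u, u != root & (size h + depth u == height)%N]
       then enc (aggregate (own u x r) h) else [::])
    (fun x r h => out (aggregate (own root x r) h)).

Lemma height_le_diameter : (height <= diameter e)%N.
Proof. by apply/bigmax_leqP => u _; exact: gdist_le_diameter. Qed.

Lemma parentP (u : V) : connected_graph e -> u != root ->
  e u (parent u) /\ (depth (parent u)).+1 = depth u.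
Proof.
move=> conn ur; have [w uw dw] := gdist_predecessor conn ur.
rewrite /parent; case: pickP => [z /andP[uz /eqP dz]|/(_ w)] //=.
by rewrite uw /depth dw eqxx.
Qed.

Section Run.
Variables (X : V -> I) (r : L.-tuple bool).

Let hist : nat -> V -> seq (inbox V) := @history V e I O convergecast X r.
Let value (t : nat) (u : V) : A := aggregate (own u (X u) r) (hist t u).

Lemma size_history (t : nat) (u : V) : size (hist t u) = t.
Proof. by elim: t => //= t IH; rewrite size_rcons IH. Qed.

Lemma messageE (t : nat) (u v : V) :
  @message V e I O convergecast X r (hist t) u v =
  if [&& e u v, v == parent u, u != root & (t + depth u == height)%N]
  then enc (value t u) else [::].
Proof. by rewrite /message /= size_history; case: (e u v). Qed.

Hypotheses (enc_size : forall a, size (enc a) = len).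

(** The condition on [t + depth u] holds for at most one round [t], so [u] speaks at most once. *)
Lemma convergecast_bits_sent (u v : V) :
  (@bits_sent V e I O convergecast X r u v <= (v == parent u) * len)%N.
Proof.
apply: (@leq_trans (\sum_(t < height)
    (if (t + depth u == height)%N then (v == parent u) * len else 0))).
  apply: leq_sum => t _; rewrite messageE.
  case: (e u v); case: (v == parent u); case: (u != root) => //=.
    by case: ifP => // _; rewrite enc_size mul1n.
rewrite -big_mkcond /= sum_nat_const -[leqRHS]mul1n leq_mul2r; apply/orP; right.
apply/card_le1_eqP => i j; rewrite !unfold_in => /eqP ti /eqP tj.
by apply/val_inj/eqP; rewrite -(eqn_add2r (depth u)) /= ti tj.
Qed.

Lemma convergecast_total_communication :
  (@total_communication V e I O convergecast X r <= #|V| * len)%N.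
Proof.
rewrite -sum_nat_const; apply: leq_sum => u _.
apply: leq_trans (leq_sum _ (fun v _ => convergecast_bits_sent u v)) _.
rewrite (bigD1 (parent u)) //= eqxx mul1n big1 ?addn0 // => v.
by move=> /negbTE ->.
Qed.

Lemma convergecast_max_communication :
  (@max_communication V e I O convergecast X r <= 2 * len)%N.
Proof.
apply/bigmax_leqP => u _; apply/bigmax_leqP => v _.
rewrite mul2n -addnn; apply: leq_add;
  apply: leq_trans (convergecast_bits_sent _ _) _; by case: eqP; rewrite ?mul1n.
Qed.

Hypotheses (dec_enc : forall a, dec (enc a) = Some a) (dec_nil : dec [::] = None).
Hypotheses (conn : connected_graph e).
Variable good : pred A.
Hypothesis good_op : forall a b, good (op a b) = good a && good b.

Let good_msg (s : seq bool) : bool := if dec s is Some c then good c else true.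

(** A predicate turning [op] into conjunction is insensitive to the order and multiplicity of
    merging, so it can be followed through the whole tree. *)
Lemma good_aggregate (a : A) (h : seq (inbox V)) :
  good (aggregate a h)
  = good a && all (fun b : inbox V => [forall w, good_msg (b w)]) h.
Proof.
have inner (b : inbox V) c s :
    good (foldr (absorb b) c s) = good c && all (fun w => good_msg (b w)) s.
  elim: s => [|w s IH] /=; first by rewrite andbT.
  rewrite /absorb /good_msg -/(absorb b).
  by case: (dec (b w)) => [z|] //; rewrite good_op IH andbCA.
elim: h => [|b h IH] /=; first by rewrite andbT.
rewrite inner IH -andbA [all _ h && _]andbC; congr (_ && (_ && _)).
by apply/allP/forallP => H w *; apply: H; rewrite ?mem_enum.
Qed.

Lemma good_values : (forall v, good (own v (X v) r)) ->
  forall t u, good (value t u).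
Proof.
move=> gown; elim=> [|t IH] u; first exact: gown.
rewrite /value good_aggregate /= all_rcons.
have := IH u; rewrite /value good_aggregate => /andP[-> ->] /=.
rewrite andbT; apply/forallP => w; rewrite ffunE messageE /good_msg.
by case: ifP; rewrite ?dec_enc ?dec_nil.
Qed.

(** Induction on the depth: the message of a vertex arrives in the last inbox its parent reads
    before speaking, so goodness of the parent's value descends to it. *)
Lemma good_root : good (value height root) -> forall v, good (own v (X v) r).
Proof.
move=> groot v; suff : good (value (height - depth v) v).
  by rewrite /value good_aggregate => /andP[].
move: {2}(depth v) (erefl (depth v)) => k; elim: k v => [|k IH] v dv.
  rewrite dv subn0; have [->//|vr] := eqVneq v root.
  by have [_] := parentP conn vr; rewrite dv.
have vr : v != root by apply: contraPneq dv => ->; rewrite /depth gdist_refl.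
have [ev dp] := parentP conn vr.
have dk : depth (parent v) = k by move: dp; rewrite dv => -[].
have kh : (k < height)%N by rewrite -dv; exact: (@leq_bigmax _ depth v).
have := IH _ dk; rewrite dk dv -{1}(subnSK kh) /value good_aggregate /=.
case/andP=> _; rewrite all_rcons => /andP[/forallP /(_ v) + _].
rewrite ffunE messageE ev eqxx vr dv subnK // eqxx /=.
by rewrite /good_msg dec_enc.
Qed.

Lemma good_convergecast :
  good (value height root) = [forall v, good (own v (X v) r)].
Proof.
by apply/idP/forallP => [|gown]; [exact: good_root | exact: good_values].
Qed.

End Run.

Lemma convergecast_result (X : V -> I) (r : L.-tuple bool) :
    (forall a, dec (enc a) = Some a) -> dec [::] = None -> connected_graph e ->
  exists2 a, @result V e I O convergecast X r root = out a &
  forall good : pred A, (forall a b, good (op a b) = good a && good b) ->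
    good a = [forall v, good (own v (X v) r)].
Proof.
move=> dec_enc dec_nil conn.
exists (aggregate (own root (X root) r)
  (@history V e I O convergecast X r height root)) => // good good_op.
exact: good_convergecast.
Qed.

End Convergecast.

(** * The estimator *)

Section Estimator.
Variable R : realType.

Lemma expRN1_ge : 4^-1 <= expR (-1) :> R.
Proof.
have -> : expR (-1) = expR (- 2^-1) ^+ 2 :> R.
  by rewrite -expRM_natr; congr expR; field.
have h : 2^-1 <= expR (- 2^-1) :> R.
  by apply: le_trans (expR_ge1Dx _); lra.
have -> : 4^-1 = 2^-1 ^+ 2 :> R by field.
by apply: lerXn2r; rewrite ?nnegrE ?expR_ge0 // invr_ge0.
Qed.

(** With [y = ln (lambda F)], the survival probability [exp(-exp y)] has slope [-1/e] at 0, hence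
    changes by at least [eta / 8] over a distance [eta]. *)
Lemma expR_tail_above (eta y : R) : 0 < eta <= 2^-1 -> eta <= y ->
  expR (- expR y) <= expR (-1) - eta / 8.
Proof.
move=> /andP[eta0 eta1] ey; have e1 := expRN1_ge.
have ey1 : 1 + eta <= expR y by apply: le_trans (expR_ge1Dx _); lra.
have : expR (- expR y) <= expR (-1) * expR (- eta).
  by rewrite -expRD ler_expR; lra.
have := expR_quadratic (ltW eta0); rewrite ler_norml => /andP[q _].
have : expR (- eta) <= 1 - eta / 2 by nra.
by nra.
Qed.

Lemma expR_tail_below (eta y : R) : 0 < eta <= 2^-1 -> y <= - eta ->
  expR (-1) + eta / 8 <= expR (- expR y).
Proof.
move=> /andP[eta0 eta1] ye; have e1 := expRN1_ge.
have := expR_quadratic (ltW eta0); rewrite ler_norml => /andP[q _].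
have e2 : expR (- eta) <= 1 - eta / 2 by nra.
have e3 : expR y <= expR (- eta) by rewrite ler_expR.
apply: (@le_trans _ _ (expR (-1) * expR (eta / 2))).
  have := expR_ge1Dx (eta / 2); nra.
by rewrite -expRD ler_expR; lra.
Qed.

(** The offset makes [lambda F <= exp(-eta)] at level 0 whenever [F <= exp Lam]. *)
Definition level_rate (eta Lam : R) (l : nat) : R :=
  expR (eta * l%:R - Lam - eta).

Definition crossing (B k : nat) (N : nat -> nat) : nat :=
  find (fun l => (N l)%:R < k%:R * expR (-1) :> R) (iota 0 B).

(* The rates [level_rate] only reach values useful for [1 <= F_p <= exp Lam], so
   the absence of a crossing signals the zero vector. *)
Definition estimate (eta Lam p : R) (B k : nat) (N : nat -> nat) : R :=
  let l := crossing B k N in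
  if (l < B)%N then expR ((Lam + eta - eta * l%:R) / p) else 0.

Lemma level_rate_ge0 (eta Lam : R) (l : nat) : 0 <= level_rate eta Lam l.
Proof. exact: expR_ge0. Qed.

Lemma level_rate_homo (eta Lam : R) : 0 <= eta ->
  {homo level_rate eta Lam : i j / (i <= j)%N >-> i <= j}.
Proof.
move=> eta0 i j ij; rewrite ler_expR !lerD2r.
by apply: ler_wpM2l; rewrite ?ler_nat.
Qed.

Lemma crossing_gt (B k : nat) (N : nat -> nat) (l : nat) :
    {homo N : i j / (i <= j)%N >-> (j <= i)%N} -> (l < B)%N ->
  (l < crossing B k N)%N = (k%:R * expR (-1) <= (N l)%:R :> R).
Proof.
move=> Nhomo lB; rewrite /crossing find_iota_gt // -?leNgt // => i il.
by apply: le_lt_trans; rewrite ler_nat Nhomo.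
Qed.

Lemma eq_estimate (eta Lam p : R) (B k : nat) (N N' : nat -> nat) :
  N =1 N' -> estimate eta Lam p B k N = estimate eta Lam p B k N'.
Proof.
by move=> NN; rewrite /estimate /crossing; under eq_find do rewrite NN.
Qed.

Section Accuracy.
Variables (p eps eta Lam : R) (B k : nat) (N : nat -> nat) (s : nat -> R).

(** The survival probabilities at [a] and [a + 3] would ideally lie [eta / 8] above and below [1/e];
    half of this margin covers the bias and half the sampling error. Counts being monotone, these
    two levels alone trap the crossing. *)
Lemma estimate_accurate (F : R) :
  let a := Num.trunc ((Lam - ln F) / eta) in
    0 < p < 1 -> 0 < eps < 1 -> eta = p * eps / 4 -> (0 < k)%N ->
    (a + 3 < B)%N -> {homo N : i j / (i <= j)%N >-> (j <= i)%N} ->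
    1 <= F <= expR Lam ->
    (forall l, (l < B)%N ->
      `|s l - expR (- (level_rate eta Lam l * F))| <= eta / 16) ->
    `|(N a)%:R / k%:R - s a| < eta / 16 ->
    `|(N (a + 3)%N)%:R / k%:R - s (a + 3)%N| < eta / 16 ->
  approximates eps (estimate eta Lam p B k N) (F `^ p^-1).
Proof.
move=> a hp heps etaE k0 aB Nhomo /andP[F1 FL] sE sa sb.
case/andP: (hp) => p0 p1; case/andP: (heps) => eps0 eps1.
have eta0 : 0 < eta by rewrite etaE divr_gt0 ?mulr_gt0.
have eta1 : eta <= 2^-1 by nra.
have F0 : 0 < F by lra.
have k0' : 0 < k%:R :> R by rewrite ltr0n.
(* [y l] is the logarithm of [level_rate eta Lam l * F], and also [-p] times the logarithmic error
   of an estimate made at level [l]. *)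
pose y l : R := eta * l%:R - Lam - eta + ln F.
have rateE l : level_rate eta Lam l * F = expR (y l).
  by rewrite -{1}[F]lnK ?posrE // -expRD.
have lnFL : 0 <= (Lam - ln F) / eta.
  by rewrite divr_ge0 ?(ltW eta0) ?subr_ge0 // -ler_expR lnK ?posrE.
have [ale agt] : eta * a%:R <= Lam - ln F /\ Lam - ln F < eta * a%:R + eta.
  have /andP[t1 t2] := truncn_itv lnFL.
  rewrite mulrC -ler_pdivlMr //; split=> //.
  by move: t2; rewrite ltr_pdivrMr // -natr1 mulrDl mul1r mulrC.
have yS l : y (l + 3)%N = y l + 3 * eta by rewrite /y natrD; ring.
have ca : (a < crossing B k N)%N.
  rewrite crossing_gt //; last by apply: leq_ltn_trans aB; rewrite leq_addr.
  have ya : y a <= - eta by rewrite /y; lra.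
  have h : 0 < eta <= 2^-1 by rewrite eta0.
  have := expR_tail_below h ya; rewrite -rateE.
  have aB' : (a < B)%N by apply: leq_ltn_trans aB; rewrite leq_addr.
  have := sE _ aB'; move: sa; rewrite ltr_norml ler_norml.
  move=> /andP[h1 h2] /andP[h3 h4] h5.
  by rewrite mulrC -ler_pdivlMr //; lra.
have cb : (crossing B k N <= a + 3)%N.
  rewrite leqNgt crossing_gt // -ltNge.
  have ya : eta <= y (a + 3)%N by rewrite yS /y; lra.
  have h : 0 < eta <= 2^-1 by rewrite eta0.
  have := expR_tail_above h ya; rewrite -rateE.
  have := sE _ aB; move: sb; rewrite ltr_norml ler_norml.
  move=> /andP[h1 h2] /andP[h3 h4] h5.
  by rewrite mulrC -ltr_pdivrMr //; lra.
rewrite /approximates /estimate; set l := crossing B k N in ca cb *.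
rewrite (leq_ltn_trans cb aB).
have yl : - eta <= y l <= 2 * eta.
  have l1 : a%:R + 1 <= l%:R :> R by rewrite natr1 ler_nat.
  have l2 : l%:R <= a%:R + 3 :> R by rewrite -natrD ler_nat.
  have l1' : eta * (a%:R + 1) <= eta * l%:R by rewrite ler_pM2l.
  have l2' : eta * l%:R <= eta * (a%:R + 3) by rewrite ler_pM2l.
  by apply/andP; split; rewrite /y; lra.
have -> : expR ((Lam + eta - eta * l%:R) / p)
    = F `^ p^-1 * expR (- y l / p).
  rewrite /powR gt_eqF // -expRD; congr expR; rewrite /y; field.
  by rewrite gt_eqF.
set G := F `^ _; have G0 : 0 <= G by exact: powR_ge0.
rewrite -[X in _ - X]mulr1 -mulrBr normrM (ger0_norm G0) mulrC.
apply: ler_wpM2r => //.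
have [u1 u2] : - (eps / 2) <= - y l / p /\ - y l / p <= eps / 4.
  case/andP: yl => yl1 yl2; rewrite ler_pdivlMr // ler_pdivrMr //.
  by split; nra.
have v1 : 1 - eps / 2 <= expR (- y l / p).
  by apply: le_trans (expR_ge1Dx _); lra.
have v2 : expR (- y l / p) <= 1 + eps.
  apply: (@le_trans _ _ (expR (eps / 4))); first by rewrite ler_expR.
  rewrite -[eps / 4]opprK expRN; have := expR_ge1Dx (- (eps / 4)) => e1.
  apply: (@le_trans _ _ (1 + - (eps / 4))^-1).
    by rewrite lef_pV2 ?posrE ?expR_gt0 //; lra.
  rewrite -div1r ler_pdivrMr; last by lra.
  by nra.
by rewrite ler_norml; apply/andP; split; lra.
Qed.

(** The frequency at the last level exceeds [1 - eta / 8], which is above [exp(-1)]; monotonicity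
    rules out an earlier crossing. *)
Lemma estimate_zero :
    0 < eta <= 2^-1 -> (0 < k)%N ->
    {homo N : i j / (i <= j)%N >-> (j <= i)%N} -> (0 < B)%N ->
    1 - eta / 16 <= s B.-1 -> `|(N B.-1)%:R / k%:R - s B.-1| < eta / 16 ->
  estimate eta Lam p B k N = 0.
Proof.
move=> /andP[eta0 eta1] k0 Nhomo B0 s1; rewrite ltr_norml => /andP[h1 h2].
have k0' : 0 < k%:R :> R by rewrite ltr0n.
have PB : (B.-1 < B)%N by rewrite prednK.
have : (B.-1 < crossing B k N)%N.
  rewrite crossing_gt // mulrC -ler_pdivlMr //.
  by have := @expR_half_le R 1 (lexx _); lra.
by rewrite prednK // /estimate ltnNge => ->.
Qed.

End Accuracy.

End Estimator.

(** * Polynomial and logarithmic size bounds *)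

Section Bounds.
Variable R : realType.

(** For [n >= 3] this keeps [ln (ln n)] above a positive constant, able to absorb additive
    constants. Numerically, [1/e >= (5/6)^6 > 1/3]. *)
Lemma ln3_gt1 : 1 < ln 3 :> R.
Proof.
rewrite -ltr_expR lnK ?posrE // -[X in expR X]opprK expRN.
rewrite invf_plt ?posrE ?expR_gt0 //.
have -> : expR (-1) = expR (- 6^-1) ^+ 6 :> R.
  by rewrite -expRM_natr; congr expR; field.
apply: (@lt_le_trans _ _ ((5 / 6) ^+ 6)); first by lra.
apply: lerXn2r; rewrite ?nnegrE ?expR_ge0 ?divr_ge0 //.
by apply: le_trans (expR_ge1Dx _); lra.
Qed.

Lemma Fp_zero_or_ge1 (p : R) (n M : nat) (V : finType)
    (X : V -> {ffun 'I_n -> 'I_M.+1}) : 0 < p ->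
  Fp p (sum_vector R X) = 0 \/ 1 <= Fp p (sum_vector R X).
Proof.
move=> p0.
case: (boolP [forall j, (\sum_(v : V) X v j)%N == 0%N]) => [/forallP H|].
  left; apply: big1 => j _; rewrite /sum_vector (eqP (H j)) normr0 powR0 //.
  by rewrite gt_eqF.
move=> /forallPn[j]; rewrite -lt0n => Xj; right.
rewrite /Fp (bigD1 j) //= -[leLHS]addr0; apply: lerD.
  apply: (@le_trans _ _ (1 `^ p)); first by rewrite powR1.
  apply: ge0_ler_powR; rewrite ?nnegrE ?(ltW p0) //.
  by rewrite ger0_norm // ler1n.
by apply: sumr_ge0 => i _; exact: powR_ge0.
Qed.

Lemma Fp_le (p : R) (n M : nat) (V : finType)
    (X : V -> {ffun 'I_n -> 'I_M.+1}) : 0 < p < 1 ->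
  Fp p (sum_vector R X) <= (n * (#|V| * M))%N%:R.
Proof.
move=> hp; rewrite natrM mulr_natl -[n in _ *+ n]card_ord -sumr_const.
apply: ler_sum => j _; rewrite ger0_norm // /sum_vector.
by apply: le_trans (powR_le_nat _ hp) _; rewrite ler_nat card_sum_vector_le.
Qed.

Lemma polynomial_le_expR (K c x y : R) : 1 <= ln x -> y <= K * x `^ c ->
  y <= expR ((`|K| + `|c|) * ln x).
Proof.
move=> x1 /le_trans; apply.
have x0 : x != 0.
  by apply: contraTneq x1 => ->; rewrite ln0 // -ltNge ltr01.
rewrite /powR (negbTE x0) mulrDl expRD.
apply: (@le_trans _ _ (`|K| * expR (c * ln x))).
  by rewrite ler_wpM2r ?expR_ge0 ?ler_norm.
apply: ler_pM; rewrite ?expR_ge0 //.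
  apply: (@le_trans _ _ (1 + `|K| * ln x)); last exact: expR_ge1Dx.
  by have := normr_ge0 K; nra.
by rewrite ler_expR ler_wpM2r ?ler_norm //; lra.
Qed.

Lemma up_log2_le (a : nat) : (1 < a)%N -> (up_log 2 a)%:R <= 1 + 2 * ln a%:R :> R.
Proof.
move=> a1; have b0 : (0 < up_log 2 a)%N by rewrite up_log_gt0 a1.
have := up_log_gtn (isT : 1 < 2)%N a1; rewrite -(ltr_nat R) natrX.
rewrite -{2}(prednK b0) -[_.-1.+1%:R]natr1 [_ + 1]addrC.
move: _.-1 => b ab; rewrite lerD2l.
have a0 : 0 < a%:R :> R by rewrite ltr0n ltnW.
have : ln (2 ^+ b) <= ln a%:R :> R by rewrite ler_ln ?posrE ?exprn_gt0 // ltW.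
rewrite lnXn // -[ln 2 *+ b]mulr_natr => lnb.
have l2 : 2^-1 <= ln 2 :> R.
  have h : -1 < - 2^-1 :> R by lra.
  have := le_ln1Dx h; have -> : 1 - 2^-1 = 2^-1 :> R by field.
  by rewrite lnV ?posrE // lerN2.
have : 2^-1 * b%:R <= ln 2 * b%:R :> R by rewrite ler_wpM2r.
lra.
Qed.

(** [C1] comes from [k], with [2 ^+ 15 = 2 ^+ 11 * 4 ^+ 2], and [C2] from the logarithm of
    [B.+1 <= Q * ln n / eps]. The factor 2 counts both directions of an edge. *)
Lemma code_length_bound (p D : R) : 0 < p -> 0 <= D ->
  exists2 C : R, 0 < C &
  forall (eps eta : R) (n B k : nat), 0 < eps < 1 -> (2 < n)%N ->
    eta = p * eps / 4 ->
    B = (Num.trunc (D * ln n%:R / eta) + 4)%N ->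
    k = (Num.trunc (2 ^+ 11 / eta ^+ 2)).+1 ->
  (2 * (k * up_log 2 B.+1))%N%:R
    <= C * (1 / eps ^+ 2 * (ln (ln n%:R) + ln (1 / eps))).
Proof.
move=> p0 D0; have l3 := ln3_gt1.
have s00 : 0 < ln (ln 3) :> R by rewrite ln_gt0.
set s0 := ln (ln 3) in s00.
pose Q := 4 * D / p + 5.
have Q5 : 5 <= Q by rewrite lerDr divr_ge0 ?mulr_ge0 // ltW.
have lQ : 0 <= ln Q by rewrite ln_ge0 //; lra.
pose C1 := 2 ^+ 15 / p ^+ 2 + 1; pose C2 := (1 + 2 * ln Q) / s0 + 2.
have C10 : 0 < C1 by rewrite ltr_wpDl // divr_ge0 ?exprn_ge0 ?ltW.
have C20 : 0 < C2 by rewrite ltr_wpDl // divr_ge0 ?(ltW s00) //; lra.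
exists (2 * C1 * C2); first by rewrite !mulr_gt0.
move=> eps eta n B k heps n2 etaE BE kE; case/andP: (heps) => eps0 eps1.
have n0 : 0 < n%:R :> R by rewrite ltr0n ltnW // ltnW.
have ln3n : ln 3 <= ln n%:R :> R by rewrite ler_ln ?posrE // ler_nat.
set S := _ + _.
have le0 : 0 <= ln (1 / eps).
  by rewrite ln_ge0 // ler_pdivlMr // mul1r ltW.
have Ss : s0 <= S.
  rewrite -[leLHS]addr0 lerD // ler_ln ?posrE //; lra.
have eta0 : 0 < eta by rewrite etaE divr_gt0 ?mulr_gt0.
have kC : k%:R <= C1 * (1 / eps ^+ 2).
  rewrite kE -natr1 /C1 mulrDl mul1r; apply: lerD; last first.
    by rewrite ler_pdivlMr ?exprn_gt0 // mul1r exprn_ile1 // ltW.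
  apply: (@le_trans _ _ (2 ^+ 11 / eta ^+ 2)).
    by rewrite truncn_le divr_ge0 ?exprn_ge0 // ltW.
  rewrite le_eqVlt; apply/orP; left; apply/eqP; rewrite etaE.
  by field; rewrite !gt_eqF.
have bC : (up_log 2 B.+1)%:R <= C2 * S.
  apply: le_trans (up_log2_le _) _; first by rewrite BE addnS.
  have BQ : B.+1%:R <= Q * ln n%:R * (1 / eps).
    have t1 : (Num.trunc (D * ln n%:R / eta))%:R <= D * ln n%:R / eta.
      by rewrite truncn_le divr_ge0 ?mulr_ge0 ?(ltW eta0) //; lra.
    have -> : Q * ln n%:R * (1 / eps)
        = D * ln n%:R / eta + 5 * (ln n%:R * (1 / eps)).
      by rewrite /Q etaE; field; rewrite !gt_eqF.
    have e1 : 1 <= 1 / eps by rewrite ler_pdivlMr // mul1r ltW.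
    rewrite BE -addnS natrD; apply: lerD => //.
    by move: (1 / eps) e1 => z z1; nra.
  have lBS : ln B.+1%:R <= ln Q + S.
    apply: (@le_trans _ _ (ln (Q * ln n%:R * (1 / eps)))).
      rewrite ler_ln ?posrE //.
      by apply: lt_le_trans BQ; rewrite ltr0n.
    have Q0 : 0 < Q by lra.
    have lnn0 : 0 < ln n%:R :> R by lra.
    have ie0 : 0 < 1 / eps by rewrite divr_gt0.
    by rewrite lnM ?posrE ?(mulr_gt0 Q0) // lnM ?posrE // -addrA.
  have : (1 + 2 * ln Q) <= (1 + 2 * ln Q) / s0 * S.
    by rewrite mulrAC ler_pdivlMr // ler_wpM2l //; lra.
  by rewrite /C2 mulrDl; lra.
rewrite !natrM.
have -> : 2 * C1 * C2 * (1 / eps ^+ 2 * S) = 2 * (C1 * (1 / eps ^+ 2) * (C2 * S)).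
  by ring.
by apply: ler_wpM2l => //; apply: ler_pM.
Qed.

End Bounds.

(** * Success probability of the estimator *)

Section Correctness.
Variables (R : realType) (p eps Lam : R) (n M : nat) (V : finType).
Variables (T : finType) (w : T -> R).
Let eta := p * eps / 4.
Let B := (Num.trunc (Lam / eta) + 4)%N.
Let k := (Num.trunc (2 ^+ 11 / eta ^+ 2)).+1.
Variable lev : V -> {ffun 'I_n -> 'I_M.+1} -> T -> 'I_B.+1.

Definition level_count (X : V -> {ffun 'I_n -> 'I_M.+1})
    (f : {ffun 'I_k -> T}) (l : nat) : nat :=
  #|[set q | [forall v, (l < lev v (X v) (f q))%N]]|.

Lemma level_count_homo X f :
  {homo level_count X f : i j / (i <= j)%N >-> (j <= i)%N}.
Proof.
move=> i j ij; apply: subset_leq_card; apply/subsetP => q; rewrite !inE.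
by move=> /forallP H; apply/forallP => v; apply: leq_ltn_trans (H v).
Qed.

(** Accurate frequencies at two levels, fixed by [X] before sampling, suffice. Each fails with
    probability at most 1/8, since [k * (eta / 16) ^+ 2 > 2 ^+ 11 / 2 ^+ 8]. *)
Lemma estimate_probability (X : V -> {ffun 'I_n -> 'I_M.+1}) :
    0 < p < 1 -> 0 < eps < 1 -> 0 <= Lam -> distribution w ->
    Fp p (sum_vector R X) <= expR Lam ->
    (forall l, (l < B)%N ->
      `|prob w (fun o => [forall v, (l < lev v (X v) o)%N])
        - expR (- (level_rate eta Lam l * Fp p (sum_vector R X)))|
      <= eta / 16) ->
  3 / 4 <= prob (product_weight (fun _ : 'I_k => w)) (fun f =>
    approximates eps (estimate eta Lam p B k (level_count X f))
      (pnorm p (sum_vector R X))).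
Proof.
move=> hp heps Lam0 wd FL approx; case/andP: (hp) => p0 p1.
case/andP: (heps) => eps0 eps1.
have eta0 : 0 < eta by rewrite divr_gt0 ?mulr_gt0.
have eta1 : eta <= 2^-1 by rewrite /eta; nra.
set P := product_weight _.
have Pd : distribution P by exact: product_distribution.
pose s l := prob w (fun o => [forall v, (l < lev v (X v) o)%N]).
pose bad l (f : {ffun 'I_k -> T}) :=
  eta / 16 <= `|(level_count X f l)%:R / k%:R - s l|.
have bad_le l : prob P (bad l) <= 8^-1.
  apply: le_trans (chebyshev_frequency
    (fun o => [forall v, (l < lev v (X v) o)%N]) wd (ltn0Sn _) _) _.
    by rewrite divr_gt0.
  have : 2 ^+ 11 / eta ^+ 2 < k%:R by exact: truncnS_gt.
  rewrite ltr_pdivrMr ?exprn_gt0 // => h.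
  have k0 : 0 < k%:R :> R by rewrite ltr0n.
  have e16 : 0 < eta / 16 by rewrite divr_gt0.
  have kt : 0 < k%:R * (eta / 16) ^+ 2 by rewrite mulr_gt0 ?exprn_gt0.
  rewrite lef_pV2 ?posrE //.
  have -> : k%:R * (eta / 16) ^+ 2 = k%:R * eta ^+ 2 / 2 ^+ 8.
    by move: (k%:R : R) => x; field.
  by move: (_ * eta ^+ 2) h => x; lra.
set F := Fp _ _ in FL approx *.
have [l1 [l2 good]] : exists l1 l2, forall f, ~~ bad l1 f -> ~~ bad l2 f ->
    approximates eps (estimate eta Lam p B k (level_count X f)) (F `^ p^-1).
  rewrite /bad; have [F0|F1] := Fp_zero_or_ge1 X p0.
    exists B.-1, B.-1 => f; rewrite -ltNge => h _.
    have B0 : (0 < B)%N by rewrite /B addnS.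
    rewrite (@estimate_zero _ p eta Lam B k (level_count X f) s) //.
    - rewrite /F F0 powR0 ?invr_eq0 ?gt_eqF //.
      by rewrite /approximates subrr normr0 mulr0.
    - by rewrite eta0.
    - exact: level_count_homo.
    - have BB : (B.-1 < B)%N by rewrite prednK.
      have := approx _ BB; rewrite /F F0 mulr0 oppr0 expR0 ler_norml.
      by move=> /andP[h1 _]; rewrite /s; lra.
  pose a := Num.trunc ((Lam - ln F) / eta).
  exists a, (a + 3)%N => f; rewrite -!ltNge => h1 h2.
  apply: (@estimate_accurate _ p eps eta Lam B k (level_count X f) s F) => //.
  (* As [ln F >= 0], the summand 4 in [B] leaves room for level [a + 3]. *)
  - rewrite /B -/a -addnS leq_add2r; apply: le_truncn.
    by rewrite ler_pM2r ?invr_gt0 // gerBl ln_ge0.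
  - exact: level_count_homo.
  - by rewrite F1.
rewrite /pnorm -/F; set E := (X in prob P X).
have : prob P (fun f => ~~ E f) <= prob P (bad l1) + prob P (bad l2).
  apply: prob_union => [f|f]; first by case: Pd.
  by apply: contraR; rewrite negb_or => /andP[]; exact: good.
rewrite prob_compl //; have := bad_le l1; have := bad_le l2; lra.
Qed.

End Correctness.

Theorem theorem21 (R : realType) (p : R) (hp : 0 < p < 1) (K c : R) :
  exists2 C : R, 0 < C &
  forall (eps : R) (heps : 0 < eps < 1)
    (n M : nat) (hn : (2 < n)%N)
    (V : finType) (e : rel V) (he : simple_graph e) (hconn : connected_graph e)
    (root : V)
    (hm : #|V|%:R <= K * n%:R `^ c) (hM : M%:R <= K * n%:R `^ c),
  exists P : protocol V {ffun 'I_n -> 'I_M.+1} R,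
    [/\ (* correctness *)
        forall X : V -> {ffun 'I_n -> 'I_M.+1},
          2 / 3 <= coin_prob R (fun r : (coins P).-tuple bool =>
            approximates eps (result e X r root) (pnorm p (sum_vector R X))),
        (* total communication *)
        forall (X : V -> {ffun 'I_n -> 'I_M.+1}) (r : (coins P).-tuple bool),
          (total_communication e X r)%:R
            <= C * (#|V|%:R / eps ^+ 2 * (ln (ln n%:R) + ln (1 / eps))),
        (* max communication *)
        forall (X : V -> {ffun 'I_n -> 'I_M.+1}) (r : (coins P).-tuple bool),
          (max_communication e X r)%:R
            <= C * (1 / eps ^+ 2 * (ln (ln n%:R) + ln (1 / eps))) &
        (rounds P <= diameter e)%N].
Proof.
case/andP: (hp) => p0 p1.
(* [F_p <= n * #|V| * M], and each of the last two factors is at most [exp((|K| + |c|) ln n)]. *)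
pose D := 1 + 2 * (`|K| + `|c|).
have D0 : 0 <= D by rewrite /D; have := normr_ge0 K; have := normr_ge0 c; lra.
have [C C0 lenC] := code_length_bound p0 D0; exists C => //.
move=> eps heps n M hn V e _ hconn root hm hM.
case/andP: (heps) => eps0 eps1; pose eta := p * eps / 4.
 pose k := (Num.trunc (2 ^+ 11 / eta ^+ 2)).+1.
pose Lam := D * ln n%:R; pose B := (Num.trunc (Lam / eta) + 4)%N.
have lenB := lenC eps eta n B k heps hn erefl erefl erefl.
have eta0 : 0 < eta by rewrite divr_gt0 ?mulr_gt0.
have n0 : (0 < n)%N by rewrite ltnW // ltnW.
have lnn : 1 <= ln n%:R :> R.
  apply: le_trans (ltW (ln3_gt1 R)) _.
  by rewrite ler_ln ?posrE ?ltr0n // ler_nat.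
have Lam0 : 0 <= Lam by rewrite mulr_ge0 //; lra.
have FL (X : V -> {ffun 'I_n -> 'I_M.+1}) :
    Fp p (sum_vector R X) <= expR Lam.
  apply: le_trans (Fp_le X hp) _; rewrite !natrM.
  have -> : Lam = ln n%:R + ((`|K| + `|c|) * ln n%:R + (`|K| + `|c|) * ln n%:R).
    by rewrite /Lam /D; ring.
  rewrite !expRD lnK ?posrE ?ltr0n //.
  by apply: ler_wpM2l => //; apply: ler_pM => //; exact: polynomial_le_expR.
have [||T [w [lev [wd levP]]]] := @level_sketch R p n M B V
  (level_rate eta Lam) (eta / 16) hp n0 _ (level_rate_ge0 eta Lam) _.
- by rewrite divr_gt0.
- exact/level_rate_homo/ltW.
(* This slack pays for realising the sketches by fair coins. *)
have d0 : 0 < 3 / 4 - 2 / 3 :> R by lra.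
have Pd : distribution (product_weight (fun _ : 'I_k => w)).
  exact: product_distribution.
have [L [f fP]] := dyadic_sampling Pd d0.
(* A message carries one level for each of the [k] repetitions. *)
pose A : finType := {ffun 'I_k -> 'I_B.+1}.
pose b := up_log 2 B.+1; pose len := (k * b)%N.
have b0 : (0 < b)%N by rewrite up_log_gt0 /B addnS.
have [||enc [dec [enc_size dec_enc dec_nil]]] := @fixed_length_code A len.
- rewrite card_ffun !card_ord /len mulnC expnM leq_exp2r //.
  exact: up_logP.
- by rewrite muln_gt0 b0.
pose op (x y : A) : A := [ffun q => if (x q <= y q)%N then x q else y q].
pose own v x (r : L.-tuple bool) : A := [ffun q => lev v x (f r q)].
pose out (a : A) : R :=
  estimate eta Lam p B k (fun l => #|[set q | (l < a q)%N]|).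
pose P := convergecast e root op enc dec own out.
have lenR : (2 * len)%N%:R <= C * (1 / eps ^+ 2 * (ln (ln n%:R) + ln (1 / eps))).
  exact: lenB.
exists P; split.
- move=> X; have := estimate_probability hp heps Lam0 wd (FL X) (levP X).
  set E := (X in prob _ X) => E34.
  have := fP E; rewrite -/k => fE.
  apply: (@le_trans _ _ (coin_prob R (fun r : L.-tuple bool => E (f r)))).
    by move: E34 fE; rewrite -/k; lra.
  rewrite /coin_prob ler_pM2r ?invr_gt0 ?ltr0n ?expn_gt0 // ler_nat.
  apply: subset_leq_card; apply/subsetP => r; rewrite !inE /E.
  have [a -> aP] := convergecast_result root op own out X r
    dec_enc dec_nil hconn.
  have -> : out a = estimate eta Lam p B k (level_count lev X (f r)) => //.
  apply: eq_estimate => l; congr #|pred_of_set _|.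
  (* Each threshold [l < a q] turns the minimum into a conjunction, and the output depends on the
     aggregate only through these thresholds. *)
  apply/setP => q; rewrite !inE (aP (fun a : A => (l < a q)%N)) => [|x y].
    by apply: eq_forallb => v; rewrite ffunE.
  rewrite ffunE; case: (leqP (x q) (y q)) => xy; apply/idP/andP => [lx|[]//].
    by split=> //; apply: leq_trans xy.
  by split=> //; apply: leq_trans (ltnW xy).
- move=> X r; apply: (@le_trans _ _ (#|V| * len)%N%:R).
    by rewrite ler_nat; exact: convergecast_total_communication.
  rewrite natrM -[#|V|%:R / _ * _]mulrA mulrCA; apply: ler_wpM2l => //.
  rewrite -[_^-1]mul1r; apply: le_trans lenR; rewrite ler_nat.
  by rewrite mul2n -addnn leq_addr.
- move=> X r; apply: le_trans lenR; rewrite ler_nat.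
  exact: convergecast_max_communication.
exact: height_le_diameter.
Qed.
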